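(* Let $n\ge 1$, let $\alpha=(\alpha_1,\ldots,\alpha_k)$ be a (weak) composition, let $\mathbf{b}\in\mathcal{B}^{\alpha}=\mathcal{B}^{\alpha_1}\otimes\cdots\otimes\mathcal{B}^{\alpha_k}$, and let $\mathbf{Q}$ be the corresponding fermionic multiline queue of type $(\alpha,n)$. Then for every $1\le i<k$, $$\pi\bigl(\mathcal{R}_i(\mathbf{b})\bigr)=\pi(\mathbf{b}),\qquad\text{or equivalently}\qquad \Phi\bigl(\sigma_i(\mathbf{Q})\bigr)=\Phi(\mathbf{Q}).$$
   Context: Fix $n\ge1$, $[n]=\{1,\dots,n\}$; sites are considered cyclically (in $\mathbb{Z}/n\mathbb{Z}$). A weak composition is a finite sequence of nonnegative integers. A fermionic multiline queue of type $(\alpha,n)$, $\alpha=(\alpha_1,\dots,\alpha_k)$, is a tuple $\mathbf{Q}=(Q_1,\dots,Q_k)$ with $Q_j\subseteq[n]$, $|Q_j|=\alpha_j$ (row 1 is the bottom row). Let $\mathcal{W}$ be the set of words $(a_1,\dots,a_n)$ of nonnegative integers; for $u\in\mathcal{W}$, $u_+$ is the multiset of nonzero entries. For $Q\subseteq[n]$, $\iota(Q)\in\{0,1\}^n$ is its indicator vector. Pairing. For $A,B\subseteq[n]$ ($A$ the lower row, $B$ the upper row), $\mathrm{cpair_f}(A,B)$ is: for $j=1,\dots,n$ in order, write an open bracket ''('' if $j\in B$ and then a closed bracket '')'' if $j\in A$; view the bracket word on a circle and recursively match each ''('' with a '')'' following it cyclically when there are no unmatched brackets between them. An element of $A$ or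 $B$ is paired (unpaired) if its bracket is matched (unmatched). Involution $\sigma_i$ ($1\le i<k$): acts on $\mathbf{Q}$ by moving all elements unpaired in $\mathrm{cpair_f}(Q_i,Q_{i+1})$ from row $i$ to row $i+1$ and from row $i+1$ to row $i$. Crystals. $\mathcal{B}^r$ is the set of $r$-element subsets of $[n]$ (single-column Kirillov–Reshetikhin crystal of type $A^{(1)}_{n-1}$), and a tensor product is, as a set, a Cartesian product; so $b_1\otimes\cdots\otimes b_k\in\mathcal{B}^{\alpha}$ is identified with the multiline queue $(b_1,\dots,b_k)$. The combinatorial R matrix $\mathcal{R}:\mathcal{B}^{r}\otimes\mathcal{B}^{r'}\to\mathcal{B}^{r'}\otimes\mathcal{B}^{r}$ is given by the Nakayashiki–Yamada rule, i.e. $\mathcal{R}(b\otimes c)=\sigma_1(b,c)$ (as two-row multiline queues), and $\mathcal{R}_i$ applies $\mathcal{R}$ to the factors $i,i+1$; thus $\mathcal{R}_i$ corresponds to $\sigma_i$. Projection $\pi$. Write $\mathcal{R}_{[a,b]}=\mathcal{R}_a\circ\mathcal{R}_{a+1}\circ\cdots\circ\mathcal{R}_b$ (applied right to left; identity if $b<a$) and $(X)_1$ for the first tensor factor of $X$, viewed as an indicator vector. Then $\pi(\mathbf{b})=\sum_{i=1}^k\bigl(\mathcal{R}_{[1,i-1]}(\mathbf{b})\bigr)_1\in\mathcal{W}$. Operators $Q^{(\ell)}$. For $Q\subseteq[n]$, $\ell\ge1$ and $\mathbf{u}=(u_1,\dots,u_n)\in\mathcal{W}$ with $\ell<\min(\mathbf{u}_+)$,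 define $Q^{(\ell)}(\mathbf{u})=(y_1,\dots,y_n)$ as follows. Initialize all $y_j=0$. Let $a=\min(\mathbf{u}_+)$, $K=\max(\mathbf{u}_+)$, $u^{(r)}=\{j:u_j\ge r\}$. Pairing phase: let $s$ be the maximal $r\in\{a,\dots,K\}$ with $|u^{(r)}|\ge|Q|$, if it exists, and $s=a$ otherwise. For $r=K,K-1,\dots,s$: for each $j\in Q$ which is paired in $\mathrm{cpair_f}(Q,u^{(r)})$ for the first time at step $r$, set $y_j=r$. Then for each $j\in Q$ unpaired in $\mathrm{cpair_f}(Q,u^{(s)})$, set $y_j=\ell$. Collapsing phase: for $r=s,s-1,\dots,a$: for each $j\in u^{(r)}$ newly unpaired (unpaired in $\mathrm{cpair_f}(Q,u^{(r)})$ and not unpaired in $\mathrm{cpair_f}(Q,u^{(r+1)})$), set $y_j=r-1$. For the zero word $\mathbf{w}_0=(0,\dots,0)$, $Q^{(\ell)}(\mathbf{w}_0)=\ell\cdot\iota(Q)$. Projection $\Phi$: $\Phi(\mathbf{Q})=Q_1^{(1)}\bigl(Q_2^{(2)}(\cdots Q_k^{(k)}(\mathbf{w}_0)\cdots)\bigr)$. *)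

(* Defs.v *)
From mathcomp Require Import all_boot.

Set Implicit Arguments.
Unset Strict Implicit.
Unset Printing Implicit Defensive.

Section MultilineQueues.

Variable n : nat.

(* The sites 1, ..., n are represented by 0, ..., n - 1 in 'I_n. *)
Definition word := {ffun 'I_n -> nat}.

Definition zero_word : word := [ffun=> 0].

Definition indicator (Q : {set 'I_n}) : word := [ffun j => nat_of_bool (j \in Q)].

(* Rows are listed from bottom to top and numbered from 1. *)
Definition mlq := seq {set 'I_n}.

Definition is_mlq (alpha : seq nat) (Q : mlq) : Prop :=
  [seq #|A| | A : {set 'I_n} <- Q] = alpha.

Definition mlq_row (Q : mlq) (i : nat) : {set 'I_n} := nth set0 Q i.-1.

Definition set_mlq_row (Q : mlq) (i : nat) (A : {set 'I_n}) : mlq :=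
  set_nth set0 Q i.-1 A.

(** Cyclic bracket matching *)

(* The number of steps to the right from b to a on the circle. *)
Definition cdist (b a : 'I_n) : nat := (a + n - b) %% n.

(* A partial matching is a set of pairs (b, a): the "(" of b \in B is matched
   with the ")" of a \in A. *)
Definition open_matched (M : {set 'I_n * 'I_n}) (b : 'I_n) : bool :=
  [exists a, (b, a) \in M].

Definition close_matched (M : {set 'I_n * 'I_n}) (a : 'I_n) : bool :=
  [exists b, (b, a) \in M].

(* All brackets strictly between the "(" of b and the ")" of a are matched.
   The inequalities differ because at a common site "(" precedes ")". *)
Definition between_matched (A B : {set 'I_n}) (M : {set 'I_n * 'I_n})
    (b a : 'I_n) : bool :=
  [forall c in B, (0 < cdist b c <= cdist b a) ==> open_matched M c] &&
  [forall c in A, (cdist b c < cdist b a) ==> close_matched M c].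

Definition match_step (A B : {set 'I_n}) (M : {set 'I_n * 'I_n}) :
    {set 'I_n * 'I_n} :=
  M :|: [set p | [&& p.1 \in B, p.2 \in A, ~~ open_matched M p.1,
                     ~~ close_matched M p.2 & between_matched A B M p.1 p.2]].

(* n steps suffice, since a step that is not stationary adds a pair. *)
Definition cpair (A B : {set 'I_n}) : {set 'I_n * 'I_n} :=
  iter n (match_step A B) set0.

Definition paired_lower (A B : {set 'I_n}) : {set 'I_n} :=
  [set a in A | close_matched (cpair A B) a].

Definition unpaired_lower (A B : {set 'I_n}) : {set 'I_n} :=
  A :\: paired_lower A B.

Definition paired_upper (A B : {set 'I_n}) : {set 'I_n} :=
  [set b in B | open_matched (cpair A B) b].

Definition unpaired_upper (A B : {set 'I_n}) : {set 'I_n} :=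
  B :\: paired_upper A B.

(** The involutions sigma_i and the combinatorial R matrix *)

Definition sigma (i : nat) (Q : mlq) : mlq :=
  let A := mlq_row Q i in
  let B := mlq_row Q i.+1 in
  set_mlq_row
    (set_mlq_row Q i (paired_lower A B :|: unpaired_upper A B))
    i.+1 (paired_upper A B :|: unpaired_lower A B).

(* An element b_1 (x) ... (x) b_k of a tensor product of single-column crystals
   is the sequence [:: b_1; ...; b_k], hence has type mlq. *)
Definition Rmat (x : {set 'I_n} * {set 'I_n}) : {set 'I_n} * {set 'I_n} :=
  let Q := sigma 1 [:: x.1; x.2] in (mlq_row Q 1, mlq_row Q 2).

Definition Rmat_at (i : nat) (b : mlq) : mlq :=
  let x := Rmat (mlq_row b i, mlq_row b i.+1) in
  set_mlq_row (set_mlq_row b i x.1) i.+1 x.2.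

(* R_[l, m] = R_l o R_(l+1) o ... o R_m *)
Definition Rmat_interval (l m : nat) (b : mlq) : mlq :=
  foldr Rmat_at b (index_iota l m.+1).

Definition pi_proj (b : mlq) : word :=
  [ffun j => \sum_(1 <= i < (size b).+1)
               indicator (mlq_row (Rmat_interval 1 i.-1 b) 1) j].

(** The operators Q^(l) and the projection Phi *)

Definition max_entry (u : word) : nat := \max_j u j.

(* For u <> 0 the initial value of the iterated minimum is irrelevant. *)
Definition min_pos_entry (u : word) : nat :=
  \big[minn/max_entry u]_(j | u j != 0) u j.

Definition level (u : word) (r : nat) : {set 'I_n} := [set j | r <= u j].

Definition overwrite (y : word) (S : {set 'I_n}) (v : nat) : word :=
  [ffun j => if j \in S then v else y j].

(* The candidate levels are listed in increasing order, so "last" picks the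
   maximal one, and the default value if there is none. *)
Definition threshold (Q : {set 'I_n}) (u : word) : nat :=
  last (min_pos_entry u)
    [seq r <- index_iota (min_pos_entry u) (max_entry u).+1
       | #|Q| <= #|level u r|].

Definition first_paired (Q : {set 'I_n}) (u : word) (r : nat) : {set 'I_n} :=
  [set j in paired_lower Q (level u r) |
     all (fun r' => j \notin paired_lower Q (level u r'))
         (index_iota r.+1 (max_entry u).+1)].

Definition pairing_phase (Q : {set 'I_n}) (l : nat) (u : word) : word :=
  let s := threshold Q u in
  let y := foldl (fun y r => overwrite y (first_paired Q u r) r) zero_word
             (rev (index_iota s (max_entry u).+1)) in
  overwrite y (unpaired_lower Q (level u s)) l.

Definition newly_unpaired (Q : {set 'I_n}) (u : word) (r : nat) : {set 'I_n} :=
  unpaired_upper Q (level u r) :\: unpaired_upper Q (level u r.+1).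

Definition collapsing_phase (Q : {set 'I_n}) (u y : word) : word :=
  foldl (fun y r => overwrite y (newly_unpaired Q u r) r.-1) y
    (rev (index_iota (min_pos_entry u) (threshold Q u).+1)).

(* Meaningful for 0 < l and, if u <> 0, l < min_pos_entry u; both conditions
   hold for every application of the operator in Phi. *)
Definition row_op (Q : {set 'I_n}) (l : nat) (u : word) : word :=
  if u == zero_word then [ffun j => l * indicator Q j]
  else collapsing_phase Q u (pairing_phase Q l u).

(* Q_1^(1) (Q_2^(2) (... Q_k^(k) (0) ...)) *)
Definition Phi (Q : mlq) : word :=
  foldr (fun i w => row_op (mlq_row Q i) i w) zero_word (iota 1 (size Q)).

End MultilineQueues.

(* Main.v *)
Require Import Defs.
From mathcomp Require Import all_boot zify.

(** Let [T_A C] be the lower row produced by the R matrix from rows [A] (below)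
    and [C] (above), here [transfer A C]. Unfolding [pi], the word of
    [A :: b] is the sum of the indicators of [A] and of the sets [T_A C], where
    [C] runs through the sets whose indicators sum to the word of [b]. So
    [pi b] is the sum of a recursively defined list of sets, [columns b], and
    applying [R_i] to [b] only permutes this list ([columns_Rmat_at]) provided
    that, with [(A', B')] the image of [(A, B)] under the R matrix,
    - [T_{A'} B' = A], which holds because the R matrix is an involution;
    - [T_{A'} T_{B'} = T_A T_B], the first component of the Yang-Baxter equation.

    Both facts come from a description of the cyclic bracket matching by a
    queue. If the upper row [B] is at most as large as the lower row [A], then
    every [b] in [B] is matched. Travelling once around the circle, let
    [q x] be the number of arcs passing over the gap before site [x]. Elements
    of [B] are customers, elements of [A] are services, and a service is paired
    exactly when a customer is waiting: [q] is a stationary solution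
    (a [carrier]) of a one-step recursion. If [B] is the larger row, the same
    holds in the opposite direction with the roles of the rows exchanged.
    Two stationary solutions of the recursion serve the same sites, by a
    monotone coupling argument ([served_unique]); hence any carrier found by
    whatever means computes the R matrix ([Rmat_forward], [Rmat_backward]).
    - The step of the queue is a bijection on the local states, whose inverse is
      the step of a queue running backwards, so the R matrix is an involution.
    - For row sizes weakly decreasing upwards, all six queues in the
      Yang-Baxter equation run forwards. If [p1], [p2], [p3] are the
      carriers on one side, then [p2 + (p3 - p1)^+], [min p1 p3] and
      [p2 + (p1 - p3)^+] (the combinatorial three-dimensional R) are carriers
      for the other side, and both sides have the same output; this is a local
      check ([braid_sorted]). The other orders of the sizes follow, because the
      equation is stable under applying [R_1] or [R_2] to the triple.

    It remains to see that [Phi = pi]. The map [T_A] is monotone, preserves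
    cardinalities, and [T_A C] is comparable with [A], so [columns b] is a
    chain for inclusion. Its members are then the superlevel sets of its
    multiplicity function, in some order. For such a word [u] the operator
    [Q^(l)] turns the superlevel sets [u^(r)], [r > l], into [Q] and
    the [T_Q u^(r)] ([row_opE]): an entry in [Q] counts the levels at which it
    is paired, an entry outside of [Q] counts the levels at which it is unpaired.
    Starting the rows at number [l] instead of 1 only adds the offset [l - 1] to
    the nonzero entries ([stackE]). *)

Set Implicit Arguments.
Unset Strict Implicit.
Unset Printing Implicit Defensive.

Section Circle.

Variable n : nat.
Implicit Types (x y j a : 'I_n) (A B C Q : {set 'I_n}) (M : {set 'I_n * 'I_n}).
Implicit Types (next prev : 'I_n -> 'I_n) (q : 'I_n -> nat) (u : word n).

(** * Distances on the circle *)

Lemma cdistE b a : cdist b a = if b <= a then a - b else a + n - b.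
Proof.
rewrite /cdist; have := ltn_ord a; have := ltn_ord b; case: (leqP b a) => h1 h2 h3.
  have -> : a + n - b = a - b + n by [lia]; rewrite modnDr modn_small //; lia.
by rewrite modn_small //; lia.
Qed.

Lemma cdistxx x : cdist x x = 0.
Proof. by rewrite cdistE leqnn subnn. Qed.

Lemma cdist_eq0 b a : (cdist b a == 0) = (b == a).
Proof.
by apply/eqP/eqP=> [|->]; last exact: cdistxx;
  rewrite cdistE => h; apply: val_inj => /=; have := ltn_ord a; have := ltn_ord b;
  case: ifP h; lia.
Qed.

Lemma cdist_inj b a a' : cdist b a = cdist b a' -> a = a'.
Proof.
rewrite !cdistE => h; apply: val_inj => /=.
have := ltn_ord a; have := ltn_ord a'; have := ltn_ord b.
by case: ifP h; case: ifP; lia.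
Qed.

Lemma cdist_split b c a : cdist b c <= cdist b a -> cdist b a = cdist b c + cdist c a.
Proof.
rewrite !cdistE; have := ltn_ord a; have := ltn_ord b; have := ltn_ord c.
by do !case: ifP; lia.
Qed.

Lemma cdist_lt b a : cdist b a < n.
Proof. by rewrite /cdist ltn_mod; case: n b => [[]|]. Qed.

Lemma val_ordS x : val (ordS x) = if x.+1 < n then x.+1 else 0.
Proof.
have h2 := ltn_ord x; rewrite /=; case: ltnP => h1; first by rewrite modn_small.
by have -> : x.+1 = n by [lia]; rewrite modnn.
Qed.

Lemma cdist_ordS b x :
  cdist b (ordS x) = if (cdist b x).+1 < n then (cdist b x).+1 else 0.
Proof.
rewrite !cdistE val_ordS; have := ltn_ord b; have := ltn_ord x.
by do !case: ifP; lia.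
Qed.

Definition connected next := forall x y, exists k, iter k next x = y.

Lemma ordS_connected : connected (@ordS n).
Proof.
move=> x y; exists (cdist x y).
suff H k : k <= cdist x y -> cdist x (iter k (@ordS n) x) = k.
  by apply: (@cdist_inj x); rewrite H.
elim: k => [|k IH] hk; first by rewrite /= cdistxx.
rewrite iterS cdist_ordS IH ?(ltnW hk) //.
by rewrite (leq_ltn_trans hk (cdist_lt x y)).
Qed.

Lemma ord_pred_connected : connected (@ord_pred n).
Proof.
move=> x y; have [k <-] := ordS_connected y x; exists k.
by elim: k => // k IH; rewrite iterSr [iter k.+1 _ y]iterS ordSK.
Qed.

(** * Bracket matching *)

Definition is_matching M :=
  [/\ forall b a a', (b, a) \in M -> (b, a') \in M -> a = a'
    & forall b b' a, (b, a) \in M -> (b', a) \in M -> b = b'].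

Definition nested A B M := forall b a, (b, a) \in M ->
  [/\ b \in B, a \in A & between_matched A B M b a].

Lemma open_matchedP M b : reflect (exists a, (b, a) \in M) (open_matched M b).
Proof. exact: existsP. Qed.
Lemma close_matchedP M a : reflect (exists b, (b, a) \in M) (close_matched M a).
Proof. exact: existsP. Qed.

Lemma betweenP A B M b a :
  reflect ((forall c, c \in B -> 0 < cdist b c <= cdist b a -> open_matched M c)
    /\ (forall c, c \in A -> cdist b c < cdist b a -> close_matched M c))
  (between_matched A B M b a).
Proof.
apply: (iffP andP) => -[h1 h2]; split.
- by move=> c cB; move/forall_inP: h1 => /(_ c cB)/implyP.
- by move=> c cA; move/forall_inP: h2 => /(_ c cA)/implyP.
- by apply/forall_inP => c cB; apply/implyP; exact: h1.
- by apply/forall_inP => c cA; apply/implyP; exact: h2.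
Qed.

Lemma match_stepP A B M b a :
  reflect ((b, a) \in M \/ [/\ b \in B, a \in A, ~~ open_matched M b,
             ~~ close_matched M a & between_matched A B M b a])
    ((b, a) \in match_step A B M).
Proof.
rewrite in_setU inE /=; apply: (iffP orP) => -[]; try by [left].
  by case/and5P; right; split.
by case=> *; right; apply/and5P; split.
Qed.

Lemma match_step_sub A B M : M \subset match_step A B M.
Proof. exact: subsetUl. Qed.

Lemma open_matchedS M M' b : M \subset M' -> open_matched M b -> open_matched M' b.
Proof. by move=> /subsetP s /open_matchedP[a /s h]; apply/open_matchedP; exists a. Qed.
Lemma close_matchedS M M' a : M \subset M' -> close_matched M a -> close_matched M' a.
Proof. by move=> /subsetP s /close_matchedP[b /s h]; apply/close_matchedP; exists b. Qed.

Lemma match_step_nested A B M : nested A B M -> nested A B (match_step A B M).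
Proof.
move=> nM b a; have s := match_step_sub A B M.
have bS : between_matched A B M b a -> between_matched A B (match_step A B M) b a.
  move=> /betweenP[h1 h2]; apply/betweenP; split => c cX /=.
    by move=> h; apply: open_matchedS s _; apply: h1.
  by move=> h; apply: close_matchedS s _; apply: h2.
by case/match_stepP => [/nM|] []; split=> //; exact: bS.
Qed.

(** Several pairs are added at once; were two of them to share an end, the longer
    one would enclose an unmatched end of the shorter one. *)
Lemma match_step_matching A B M : is_matching M -> is_matching (match_step A B M).
Proof.
case=> m1 m2; split.
- move=> b a a' /match_stepP[h|[bB aA ob ca /betweenP[_ bt]]]
    /match_stepP[h'|[_ aA' ob' ca' /betweenP[_ bt']]].
  + exact: m1 h h'.
  + by case/negP: ob'; apply/open_matchedP; exists a.
  + by case/negP: ob; apply/open_matchedP; exists a'.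
  + have h1 := contra (bt' a aA) ca; have h2 := contra (bt a' aA') ca'.
    by apply: (@cdist_inj b); apply/eqP; rewrite eqn_leq; lia.
- move=> b b' a /match_stepP[h|[bB aA ob ca /betweenP[bt _]]]
    /match_stepP[h'|[bB' _ ob' ca' /betweenP[bt' _]]].
  + exact: m2 h h'.
  + by case/negP: ca'; apply/close_matchedP; exists b.
  + by case/negP: ca; apply/close_matchedP; exists b'.
  + have := contra (bt b' bB') ob'; have := contra (bt' b bB) ob.
    rewrite !cdistE => h1 h2; apply: val_inj => /=; move: h1 h2.
    have := ltn_ord b; have := ltn_ord b'; have := ltn_ord a.
    by case: (leqP b b'); case: (leqP b' b); case: (leqP b a); case: (leqP b' a); lia.
Qed.

Lemma iter_match_step A B k :
  let M := iter k (match_step A B) set0 in is_matching M /\ nested A B M.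
Proof.
elim: k => [|k [IH1 IH2]] /=.
  by split; [split=> [b a a'|b b' a]; rewrite inE | move=> b a; rewrite inE].
by split; [exact: match_step_matching | exact: match_step_nested].
Qed.

Lemma cpair_matching A B : is_matching (cpair A B).
Proof. exact: (iter_match_step A B n).1. Qed.

Lemma cpair_nested A B : nested A B (cpair A B).
Proof. exact: (iter_match_step A B n).2. Qed.

Lemma matching_card_upper A B M : is_matching M -> nested A B M ->
  #|[set b in B | open_matched M b]| = #|M|.
Proof.
move=> [m1 m2] nM; rewrite -(card_in_imset (f := fst) (D := mem M)).
  apply: eq_card => b; rewrite inE; apply/andP/imsetP.
    by case=> _ /open_matchedP[a h]; exists (b, a).
  by case=> -[b' a] /= h ->; case: (nM _ _ h) => *; split=> //; apply/open_matchedP; exists a.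
by move=> [b a] [b' a'] h h' /= e; move: h'; rewrite -e => h'; rewrite (m1 _ _ _ h h').
Qed.

Lemma matching_card_lower A B M : is_matching M -> nested A B M ->
  #|[set a in A | close_matched M a]| = #|M|.
Proof.
move=> [m1 m2] nM; rewrite -(card_in_imset (f := snd) (D := mem M)).
  apply: eq_card => a; rewrite inE; apply/andP/imsetP.
    by case=> _ /close_matchedP[b h]; exists (b, a).
  by case=> -[b a'] /= h ->; case: (nM _ _ h) => *; split=> //; apply/close_matchedP; exists b.
by move=> [b a] [b' a'] h h' /= e; move: h'; rewrite -e => h'; rewrite (m2 _ _ _ h h').
Qed.

(** A step that changes the matching adds a pair, and a matching has at most [n]
    pairs. *)
Lemma cpair_stable A B : match_step A B (cpair A B) = cpair A B.
Proof.
pose N k := iter k (match_step A B) set0.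
have NE k : N k.+1 = match_step A B (N k) by [].
have NS k : N k \subset N k.+1 by exact: match_step_sub.
have grow k : (N k == N k.+1) || (k <= #|N k|).
  elim: k => [|k]; first by rewrite leq0n orbT.
  case/orP => [/eqP e|le_k]; first by rewrite [N k.+2]NE -e -NE -e eqxx.
  have [e|ne] := eqVneq (N k) (N k.+1); first by rewrite [N k.+2]NE -e -NE -e eqxx.
  by rewrite (leq_ltn_trans le_k) ?orbT // proper_card // properEneq ne NS.
have small k : #|N k| <= n.
  have [m1 m2] := iter_match_step A B k.
  by rewrite -(matching_card_upper m1 m2) -[X in _ <= X](card_ord n) max_card.
rewrite -[cpair A B]/(N n) -NE.
have /orP[/eqP <- //|le_n] := grow n.
by apply/esym/eqP; rewrite eqEcard NS (leq_trans (small n.+1)).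
Qed.

(** Unmatched brackets of both kinds cannot coexist: at minimal distance, they
    would enclose matched brackets only, and one more step would match them. *)
Lemma cpair_complete A B b a : b \in B -> a \in A ->
  open_matched (cpair A B) b || close_matched (cpair A B) a.
Proof.
set M := cpair A B => bB aA; apply/negPn; rewrite negb_or.
pose P (p : 'I_n * 'I_n) := [&& p.1 \in B, p.2 \in A,
  ~~ open_matched M p.1 & ~~ close_matched M p.2].
apply/negP => /andP[ob ca].
have Pba : P (b, a) by rewrite /P /= bB aA ob.
case: (arg_minnP (fun p => cdist p.1 p.2) Pba) => -[b0 a0] /and4P[/= bB0 aA0 ob0 ca0] min0.
have : (b0, a0) \in match_step A B M.
  apply/match_stepP; right; split=> //; apply/betweenP; split=> c cX h.
    apply: contraT => oc; have := min0 (c, a0); rewrite /P /= cX aA0 oc ca0 => /(_ isT).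
    by case/andP: h => h0 /cdist_split ->; rewrite leqNgt -[X in X < _]add0n ltn_add2r h0.
  apply: contraT => oc; have := min0 (b0, c); rewrite /P /= cX bB0 oc ob0 => /(_ isT).
  by rewrite leqNgt h.
by rewrite cpair_stable => h; case/negP: ob0; apply/open_matchedP; exists a0.
Qed.

Lemma card_paired A B : #|paired_lower A B| = #|paired_upper A B|.
Proof.
have m := cpair_matching A B; have h := @cpair_nested A B.
by rewrite (matching_card_upper m h) (matching_card_lower m h).
Qed.

Lemma paired_upper_sub A B : paired_upper A B \subset B.
Proof. by apply/subsetP => b; rewrite inE => /andP[]. Qed.
Lemma paired_lower_sub A B : paired_lower A B \subset A.
Proof. by apply/subsetP => b; rewrite inE => /andP[]. Qed.

Lemma paired_upper_full A B : #|B| <= #|A| -> paired_upper A B = B.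
Proof.
move=> le; apply/eqP; rewrite eqEcard paired_upper_sub /=.
have [e|] := eqVneq (paired_lower A B) A; first by rewrite -card_paired e.
rewrite eqEsubset paired_lower_sub /= => /subsetPn[a aA].
rewrite inE aA /= => ca; apply: subset_leq_card; apply/subsetP => b bB.
by rewrite inE bB /=; have := cpair_complete bB aA; rewrite (negbTE ca) orbF.
Qed.

Lemma paired_lower_full A B : #|A| <= #|B| -> paired_lower A B = A.
Proof.
move=> le; apply/eqP; rewrite eqEcard paired_lower_sub /=.
have [e|] := eqVneq (paired_upper A B) B; first by rewrite card_paired e.
rewrite eqEsubset paired_upper_sub /= => /subsetPn[b bB].
rewrite inE bB /= => ob; apply: subset_leq_card; apply/subsetP => a aA.
by rewrite inE aA /=; have := cpair_complete bB aA; rewrite (negbTE ob).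
Qed.

(** * The queue of a matching *)

(** At each site the customer of [B] joins the [q x] customers already waiting
    before the service of [A] takes place, as an opening bracket precedes a
    closing one at the same site. *)
Definition served A B (q : 'I_n -> nat) := [set x in A | 0 < q x + (x \in B)].

Definition carrier (next : 'I_n -> 'I_n) A B (q : 'I_n -> nat) :=
  forall x, q (next x) + (x \in served A B q) = q x + (x \in B).

(** The number of arcs over the gap that precedes [x]. *)
Definition arcs A B x : nat :=
  #|[set p in cpair A B | 0 < cdist p.1 x <= cdist p.1 p.2]|.

Lemma arcs_gt0 A B x :
  reflect (exists b a, (b, a) \in cpair A B /\ 0 < cdist b x <= cdist b a)
    (0 < arcs A B x).
Proof.
rewrite card_gt0; apply: (iffP (set0Pn _)) => [[[b a]]|[b [a [h1 h2]]]].
  by rewrite inE /= => /andP[h1 h2]; exists b, a.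
by exists (b, a); rewrite inE h1.
Qed.

(** Passing the site [x], an arc leaves if it ends there, and enters if it begins
    there. *)
Lemma arcs_step A B x :
  arcs A B (ordS x) + (x \in paired_lower A B) = arcs A B x + (x \in paired_upper A B).
Proof.
have [m1 m2] := cpair_matching A B; have nM := @cpair_nested A B.
set M := cpair A B in m1 m2 nM *.
have -> : (x \in paired_lower A B : nat) = \sum_(p in M) (p.2 == x).
  rewrite inE; case: (boolP (close_matched M x)) => [/close_matchedP[b h]|h].
    have [_ -> _] := nM _ _ h; rewrite (bigD1 (b, x)) //= eqxx big1 // => -[b' a'] /andP[h' ne].
    apply/eqP; rewrite eqb0 /=; apply: contra ne => /eqP e; move: h'; rewrite e => h'.
    by rewrite (m2 _ _ _ h h').
  rewrite andbF big1 // => -[b a] h'; apply/eqP; rewrite eqb0 /=; apply: contra h => /eqP <-.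
  by apply/close_matchedP; exists b.
have -> : (x \in paired_upper A B : nat) = \sum_(p in M) (p.1 == x).
  rewrite inE; case: (boolP (open_matched M x)) => [/open_matchedP[a h]|h].
    have [-> _ _] := nM _ _ h; rewrite (bigD1 (x, a)) //= eqxx big1 // => -[b' a'] /andP[h' ne].
    apply/eqP; rewrite eqb0 /=; apply: contra ne => /eqP e; move: h'; rewrite e => h'.
    by rewrite (m1 _ _ _ h h').
  rewrite andbF big1 // => -[b a] h'; apply/eqP; rewrite eqb0 /=; apply: contra h => /eqP <-.
  by apply/open_matchedP; exists a.
have arcsE y : arcs A B y = \sum_(p in M) (0 < cdist p.1 y <= cdist p.1 p.2).
  rewrite /arcs -sum1dep_card big_mkcondr.
  by apply: eq_bigr => p _; case: ifP.
rewrite !arcsE -!big_split; apply: eq_bigr => -[b a] _ /=.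
rewrite -(cdist_eq0 b x) cdist_ordS.
have -> : (a == x) = (cdist b a == cdist b x) by apply/eqP/eqP => [->|/cdist_inj].
have := cdist_lt b a; have := cdist_lt b x.
by case: ifP; lia.
Qed.

Lemma forward_carrier A B : #|B| <= #|A| ->
  carrier (@ordS n) A B (arcs A B) /\ paired_lower A B = served A B (arcs A B).
Proof.
move=> le; have full := paired_upper_full le; have nM := @cpair_nested A B.
have e : paired_lower A B = served A B (arcs A B).
  apply/setP => x; rewrite !inE; case: (boolP (x \in A)) => //= xA.
  rewrite addn_gt0 lt0b; apply/idP/idP.
    case/close_matchedP => b h; have [bx|ne] := eqVneq b x.
      by have [] := nM _ _ h; rewrite bx => -> ; rewrite orbT.
    apply/orP; left; apply/arcs_gt0; exists b, x.
    by rewrite leqnn lt0n cdist_eq0 ne.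
  case/orP => [/arcs_gt0[b [a [h /andP[h1 h2]]]]|xB].
    have [-> |ne] := eqVneq x a; first by apply/close_matchedP; exists b.
    have [_ _ /betweenP[_]] := nM _ _ h; apply=> //.
    by rewrite ltn_neqAle h2 andbT; apply: contra ne => /eqP/cdist_inj ->.
  have: x \in paired_upper A B by rewrite full.
  rewrite inE xB /= => /open_matchedP[a h].
  have [-> |ne] := eqVneq x a; first by apply/close_matchedP; exists x.
  have [_ _ /betweenP[_]] := nM _ _ h; apply=> //.
  by rewrite cdistxx lt0n cdist_eq0.
by split=> // x; rewrite -e arcs_step full.
Qed.

(** Read from right to left, closing brackets of [A] wait for opening brackets of
    [B]; the queue seen when arriving at [x] is the one over the gap after [x]. *)
Lemma backward_carrier A B : #|A| <= #|B| ->
  let q x := arcs A B (ordS x) in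
  carrier (@ord_pred n) B A q /\ paired_upper A B = served B A q.
Proof.
move=> le q; have full := paired_lower_full le; have nM := @cpair_nested A B.
have e : paired_upper A B = served B A q.
  apply/setP => x; rewrite !inE; case: (boolP (x \in B)) => //= xB.
  rewrite addn_gt0 lt0b; apply/idP/idP.
    case/open_matchedP => a h; have [ax|ne] := eqVneq x a.
      by have [_] := nM _ _ h; rewrite -ax => ->; rewrite orbT.
    apply/orP; left; apply/arcs_gt0; exists x, a; split=> //.
    have := cdist_eq0 x a; rewrite (negbTE ne) cdist_ordS cdistxx.
    by have := cdist_lt x a; case: ifP; lia.
  case/orP => [/arcs_gt0[b [a [h]]]|xA].
    rewrite cdist_ordS; case: ifP => // _ /andP[_ h2].
    have [<- |ne] := eqVneq b x; first by apply/open_matchedP; exists a.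
    have [_ _ /betweenP[+ _]] := nM _ _ h; apply=> //.
    by rewrite lt0n cdist_eq0 ne (ltnW h2).
  have: x \in paired_lower A B by rewrite full.
  rewrite inE xA /= => /close_matchedP[b h].
  have [bx |ne] := eqVneq b x; first by rewrite {1}bx in h; apply/open_matchedP; exists x.
  have [_ _ /betweenP[+ _]] := nM _ _ h; apply=> //.
  by rewrite leqnn lt0n cdist_eq0 ne.
by split=> // x; rewrite -e /q ord_predK; have := arcs_step A B x; rewrite full => ->.
Qed.

(** * Uniqueness and monotonicity of stationary queues *)

Lemma connected_ind next (P : 'I_n -> Prop) x0 : connected next ->
  (forall x, P x -> P (next x)) -> P x0 -> forall x, P x.
Proof. by move=> conn step P0 x; have [k <-] := conn x0 x; elim: k => // k; apply: step. Qed.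

Lemma connected_const next q : connected next ->
  (forall x, q (next x) <= q x) -> forall x, q (next x) = q x.
Proof.
move=> conn le x; apply/eqP; rewrite eqn_leq le /=; have [k {1}<-] := conn (next x) x.
by elim: k => //= k; apply: leq_trans.
Qed.

(** Two queues whose order persists, and whose positive difference can only
    shrink: either they are ordered all around the circle, or the difference is
    constant, since it returns to its initial value after one turn. *)
Lemma coupling next (f g : 'I_n -> nat) : connected next ->
  (forall x, f x <= g x -> f (next x) <= g (next x)) ->
  (forall x, g x < f x -> f (next x) - g (next x) <= f x - g x) ->
  (forall x, f x <= g x) \/
  (forall x, g x < f x /\ f (next x) + g x = f x + g (next x)).
Proof.
move=> conn mono lip.
have [/existsP[x0 le0]|] := boolP [exists x, f x <= g x].
  by left; apply: connected_ind conn mono le0.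
rewrite negb_exists => /forallP gt; right=> x.
have lt y : g y < f y by rewrite ltnNge gt.
have := connected_const conn (fun x => lip x (lt x)) x.
by have := lt x; have := lt (next x); lia.
Qed.

Lemma carrierE next A B q : carrier next A B q -> forall x,
  q (next x) = q x + (x \in B) - ((x \in A) && (0 < q x + (x \in B))).
Proof. by move=> c x; move: (c x); rewrite inE; set s := nat_of_bool (_ && _) => <-;
  rewrite addnK. Qed.

(** If the queue with more arrivals is shorter everywhere, by a constant, then both
    queues have the same balance of arrivals and departures at each site, so that
    the additional customers are served on arrival. *)
Lemma served_arrivals next A B B' q q' : connected next -> B \subset B' ->
  carrier next A B q -> carrier next A B' q' ->
  served A B q \subset served A B' q'.
Proof.
move=> conn /subsetP sB /carrierE c /carrierE c'.
have [||le|gt] := @coupling next q q' conn.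
- by move=> x; rewrite c c'; have := sB x;
    case: (x \in A); case: (x \in B); case: (x \in B') => /= sBx; try (by have := sBx isT); lia.
- by move=> x; rewrite c c'; have := sB x;
    case: (x \in A); case: (x \in B); case: (x \in B') => /= sBx; try (by have := sBx isT); lia.
- apply/subsetP => x; rewrite !inE; have := sB x; have := le x.
  by case: (x \in A); case: (x \in B); case: (x \in B') => /= ? sBx; try (by have := sBx isT); lia.
- apply/subsetP => x; rewrite !inE; have := sB x; have [] := gt x; rewrite c c'.
  by case: (x \in A); case: (x \in B); case: (x \in B') => /= ? ? sBx; try (by have := sBx isT); lia.
Qed.

(** Additional services shorten the queue or change it by a constant; in both
    cases a service that was idle remains so. *)
Lemma unserved_services next A A' B q q' : connected next -> A \subset A' ->
  carrier next A B q -> carrier next A' B q' ->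
  A :\: served A B q \subset A' :\: served A' B q'.
Proof.
move=> conn /subsetP sA /carrierE c /carrierE c'.
have [||le|gt] := @coupling next q' q conn.
- by move=> x; rewrite c c'; have := sA x;
    case: (x \in A); case: (x \in B); case: (x \in A') => /= sAx; try (by have := sAx isT); lia.
- by move=> x; rewrite c c'; have := sA x;
    case: (x \in A); case: (x \in B); case: (x \in A') => /= sAx; try (by have := sAx isT); lia.
- apply/subsetP => x; rewrite !inE; have := sA x; have := le x.
  by case: (x \in A); case: (x \in B); case: (x \in A') => /= ? sAx; try (by have := sAx isT); lia.
- apply/subsetP => x; rewrite !inE; have := sA x; have [] := gt x; rewrite c c'.
  by case: (x \in A); case: (x \in B); case: (x \in A') => /= ? ? sAx; try (by have := sAx isT); lia.
Qed.

Lemma served_unique next A B q q' : connected next ->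
  carrier next A B q -> carrier next A B q' -> served A B q = served A B q'.
Proof.
move=> conn c c'; apply/eqP; rewrite eqEsubset.
by rewrite (served_arrivals conn (subxx _) c c') (served_arrivals conn (subxx _) c' c).
Qed.

(** In a stationary queue as many customers depart as arrive. *)
Lemma card_served next prev A B q : cancel next prev -> cancel prev next ->
  carrier next A B q -> #|served A B q| = #|B|.
Proof.
move=> K K' c.
have e : \sum_x (q (next x) + (x \in served A B q)) = \sum_x (q x + (x \in B)).
  by apply: eq_bigr => x _; apply: c.
rewrite !big_split /= in e.
have e' : \sum_x q x = \sum_x q (next x).
  by rewrite (reindex next) //; exists prev => x _.
rewrite e' in e; move/addnI: e => e.
by rewrite -!sum1_card big_mkcond [RHS]big_mkcond; apply: e.
Qed.

(** * The R matrix as a queue *)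

(** When the queue runs forwards, the new lower row and the new upper row. *)
Definition pass A B q := (served A B q, B :|: (A :\: served A B q)).

Definition swap (p : {set 'I_n} * {set 'I_n}) := (p.2, p.1).

Lemma RmatE A B : Rmat (A, B) =
  (paired_lower A B :|: unpaired_upper A B, paired_upper A B :|: unpaired_lower A B).
Proof. by []. Qed.

Lemma Rmat_forward0 A B : #|B| <= #|A| -> Rmat (A, B) = pass A B (arcs A B).
Proof.
move=> le; have [c e] := forward_carrier le.
by rewrite RmatE /unpaired_upper /unpaired_lower paired_upper_full // e setDv setU0.
Qed.

Lemma Rmat_backward0 A B : #|A| <= #|B| ->
  Rmat (A, B) = swap (pass B A (fun x => arcs A B (ordS x))).
Proof.
move=> le; have [c e] := backward_carrier le.
by rewrite RmatE /unpaired_upper /unpaired_lower paired_lower_full // e setDv setU0.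
Qed.

Lemma Rmat_forward A B q : carrier (@ordS n) A B q -> Rmat (A, B) = pass A B q.
Proof.
move=> c; have le : #|B| <= #|A|.
  rewrite -(card_served (@ordSK n) (@ord_predK n) c).
  by apply: subset_leq_card; apply/subsetP => x; rewrite inE => /andP[].
by rewrite Rmat_forward0 // /pass (served_unique ordS_connected (forward_carrier le).1 c).
Qed.

Lemma Rmat_backward A B q : carrier (@ord_pred n) B A q -> Rmat (A, B) = swap (pass B A q).
Proof.
move=> c; have le : #|A| <= #|B|.
  rewrite -(card_served (@ord_predK n) (@ordSK n) c).
  by apply: subset_leq_card; apply/subsetP => x; rewrite inE => /andP[].
by rewrite Rmat_backward0 // /pass (served_unique ord_pred_connected (backward_carrier le).1 c).
Qed.

(** Time reversal: the departures, fed backwards with the arrivals and idle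
    services as new services, reproduce the arrivals. *)
Lemma pass_rev next prev A B q : cancel prev next -> carrier next A B q ->
  let p := pass A B q in
  carrier prev p.2 p.1 (fun x => q (next x)) /\ pass p.2 p.1 (fun x => q (next x)) = (B, A).
Proof.
move=> K c p.
have e : served p.2 p.1 (fun x => q (next x)) = B.
  apply/setP => x; have := carrierE c x; rewrite !inE => ->.
  by case: (x \in A); case: (x \in B) => /=; lia.
split.
  by move=> x; rewrite e /= K c.
rewrite /pass e; congr (_, _); apply/setP => x; rewrite !inE.
by case: (x \in A); case: (x \in B) => /=; lia.
Qed.

Lemma RmatK : involutive (@Rmat n).
Proof.
move=> [A B]; case: (leqP #|B| #|A|) => [le|/ltnW le].
  have [c _] := forward_carrier le; rewrite (Rmat_forward c).
  have [c' e] := pass_rev (@ord_predK n) c.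
  by rewrite (surjective_pairing (pass _ _ _)) (Rmat_backward c') e.
have [c _] := backward_carrier le; rewrite (Rmat_backward c).
have [c' e] := pass_rev (@ordSK n) c.
by rewrite (Rmat_forward c') e.
Qed.

Lemma card_Rmat A B : #|(Rmat (A, B)).1| = #|B| /\ #|(Rmat (A, B)).2| = #|A|.
Proof.
have card_pass next prev A' B' q : cancel next prev -> cancel prev next -> carrier next A' B' q ->
    #|(pass A' B' q).1| = #|B'| /\ #|(pass A' B' q).2| = #|A'|.
  move=> K K' c; split; first exact: card_served c.
  have sub : served A' B' q \subset A' by apply/subsetP => x; rewrite inE => /andP[].
  have dis : B' :&: (A' :\: served A' B' q) = set0.
    by apply/setP => x; rewrite !inE; case: (x \in B'); case: (x \in A'); rewrite //= addn1.
  rewrite cardsU dis cards0 subn0 cardsD (setIidPr sub) (card_served K K' c).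
  by rewrite subnKC // -(card_served K K' c) subset_leq_card.
case: (leqP #|B| #|A|) => [le|/ltnW le].
  have [c _] := forward_carrier le; rewrite (Rmat_forward c).
  exact: card_pass (@ordSK n) (@ord_predK n) c.
have [c _] := backward_carrier le; rewrite (Rmat_backward c).
by have [] := card_pass _ _ _ _ _ (@ord_predK n) (@ordSK n) c.
Qed.

(** * The Yang-Baxter equation *)

Definition R12 (X : {set 'I_n} * {set 'I_n} * {set 'I_n}) :=
  let: (A, B, C) := X in let: (A', B') := Rmat (A, B) in (A', B', C).
Definition R23 (X : {set 'I_n} * {set 'I_n} * {set 'I_n}) :=
  let: (A, B, C) := X in let: (B', C') := Rmat (B, C) in (A, B', C').

Arguments R12 : simpl never.
Arguments R23 : simpl never.

Definition braid X := R12 (R23 (R12 X)) = R23 (R12 (R23 X)).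

Lemma R12K : involutive R12.
Proof.
move=> [[A B] C]; rewrite /R12; case e: (Rmat (A, B)) => [A' B'].
by rewrite -e RmatK.
Qed.
Lemma R23K : involutive R23.
Proof.
move=> [[A B] C]; rewrite /R23; case e: (Rmat (B, C)) => [A' B'].
by rewrite -e RmatK.
Qed.

(** The equation at [R_1 X] is [R_1 R_2 X = R_2 R_1 R_2 R_1 X]; an application of
    [R_2] to both sides turns it into the equation at [X]. *)
Lemma braid12 X : braid (R12 X) -> braid X.
Proof. by rewrite /braid R12K => ->; rewrite R23K. Qed.
Lemma braid23 X : braid (R23 X) -> braid X.
Proof. by rewrite /braid R23K => <-; rewrite R12K. Qed.

Lemma ex_forward A B : #|B| <= #|A| -> exists q, carrier (@ordS n) A B q.
Proof. by move/forward_carrier => [c _]; exists (arcs A B). Qed.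

Lemma R12_forward A B C q : carrier (@ordS n) A B q ->
  R12 (A, B, C) = (served A B q, B :|: (A :\: served A B q), C).
Proof. by move=> c; rewrite /R12 (Rmat_forward c). Qed.
Lemma R23_forward A B C q : carrier (@ordS n) B C q ->
  R23 (A, B, C) = (A, served B C q, C :|: (B :\: served B C q)).
Proof. by move=> c; rewrite /R23 (Rmat_forward c). Qed.

(** With these sizes all queues run forwards, and the stationary states of one
    side are transported to the other by the combinatorial three-dimensional R. *)
Lemma braid_sorted A B C : #|C| <= #|B| -> #|B| <= #|A| -> braid (A, B, C).
Proof.
move=> CB BA; have [p1 c1] := ex_forward BA.
have [] := card_Rmat A B; rewrite /braid (Rmat_forward c1) (R12_forward C c1) /=.
set A1 := served A B p1; set B1 := B :|: _ => sA1 sB1.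
have [|p2 c2] := @ex_forward B1 C; first by rewrite sB1 (leq_trans CB).
have [] := card_Rmat B1 C; rewrite (Rmat_forward c2) (R23_forward A1 c2) /=.
set B2 := served B1 C p2; set C2 := C :|: _ => sB2 sC2.
have [|p3 c3] := @ex_forward A1 B2; first by rewrite sB2 sA1.
rewrite (R12_forward C2 c3).
have {}c1 := carrierE c1; have {}c2 := carrierE c2; have {}c3 := carrierE c3.
(* Conservation of customers suggests [r2 + r3 = p1 + p2] and [r1 + r2 = p2 + p3],
   which leaves [r2] to be found. *)
pose r1 x := p2 x + (p3 x - p1 x).
pose r2 x := minn (p1 x) (p3 x).
pose r3 x := p2 x + (p1 x - p3 x).
have d1 : carrier (@ordS n) B C r1.
  move=> x; rewrite /r1 c1 c2 c3 /C2 /B2 /B1 /A1 !inE.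
  by case: (x \in A); case: (x \in B); case: (x \in C) => /=; lia.
rewrite (R23_forward A d1).
set B3 := served B C r1; set C3 := C :|: (B :\: _).
have d2 : carrier (@ordS n) A B3 r2.
  move=> x; rewrite /r2 c1 c3 /C2 /B2 /B1 /A1 /B3 /r1 !inE.
  by case: (x \in A); case: (x \in B); case: (x \in C) => /=; lia.
rewrite (R12_forward C3 d2).
set A4 := served A B3 r2; set B4 := B3 :|: (A :\: _).
have d3 : carrier (@ordS n) B4 C3 r3.
  move=> x; rewrite /r3 c1 c2 c3 /B4 /A4 /C3 /r2 /C2 /B2 /B1 /A1 /B3 /r1 !inE.
  by case: (x \in A); case: (x \in B); case: (x \in C) => /=; lia.
rewrite (R23_forward A4 d3).
congr (_, _, _); apply/setP => x;
  rewrite /B4 /A4 /C3 /C2 /B2 /B1 /A1 /B3 /r3 /r2 /r1 !inE;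
  by case: (x \in A); case: (x \in B); case: (x \in C) => /=; lia.
Qed.

(** [R_1] and [R_2] permute the sizes, so that any triple is reduced to the sorted
    case: once the smallest set is on top, at most one more exchange is needed. *)
Lemma braidP X : braid X.
Proof.
have last_min A B C : #|C| <= #|A| -> #|C| <= #|B| -> braid (A, B, C).
  move=> CA CB; case: (leqP #|B| #|A|) => [BA|/ltnW AB]; first exact: braid_sorted.
  apply: braid12; rewrite /R12; have [] := card_Rmat A B.
  by case: (Rmat (A, B)) => A' B' /= e1 e2; apply: braid_sorted; rewrite ?e1 ?e2.
case: X => [[A B] C].
case: (leqP #|C| #|B|) => CB; case: (leqP #|C| #|A|) => CA; first exact: last_min.
- apply: braid12; rewrite /R12; have [] := card_Rmat A B.
  case: (Rmat (A, B)) => A' B' /= e1 e2.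
  apply: braid23; rewrite /R23; have [] := card_Rmat B' C.
  case: (Rmat (B', C)) => B'' C' /= e3 e4.
  by apply: last_min; rewrite e4 e2 ?e1 ?e3 ?(ltnW CA) // (leq_trans (ltnW CA)).
- apply: braid23; rewrite /R23; have [] := card_Rmat B C.
  case: (Rmat (B, C)) => B' C' /= e1 e2.
  by apply: last_min; rewrite e2 ?e1 ?(ltnW CB) // (leq_trans (ltnW CB)).
- case: (leqP #|B| #|A|) => BA.
    apply: braid23; rewrite /R23; have [] := card_Rmat B C.
    case: (Rmat (B, C)) => B' C' /= e1 e2.
    by apply: last_min; rewrite e2 ?e1 // ltnW.
  apply: braid12; rewrite /R12; have [] := card_Rmat A B.
  case: (Rmat (A, B)) => A' B' /= e1 e2.
  apply: braid23; rewrite /R23; have [] := card_Rmat B' C.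
  case: (Rmat (B', C)) => B'' C' /= e3 e4.
  by apply: last_min; rewrite e4 e2 ?e1 ?e3 ltnW.
Qed.

(** * The transfer operator of a row *)

Lemma unpaired_upper_disjoint A B x : x \in unpaired_upper A B -> x \notin A.
Proof.
rewrite in_setD; case: (leqP #|B| #|A|) => [le|/ltnW le].
  by rewrite paired_upper_full // andNb.
have [_ ->] := backward_carrier le; rewrite !inE => /andP[+ xB]; rewrite xB /=.
by apply: contra => ->; rewrite addn1.
Qed.

Lemma paired_lower_mono Q C C' : C \subset C' ->
  paired_lower Q C \subset paired_lower Q C'.
Proof.
move=> sC; case: (leqP #|Q| #|C'|) => [le|/ltnW le].
  by rewrite (paired_lower_full le) paired_lower_sub.
have [c e] := forward_carrier (leq_trans (subset_leq_card sC) le).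
have [c' e'] := forward_carrier le.
by rewrite e e'; apply: served_arrivals sC c c'; apply: ordS_connected.
Qed.

Lemma unpaired_upper_mono Q C C' : C \subset C' ->
  unpaired_upper Q C \subset unpaired_upper Q C'.
Proof.
move=> sC; case: (leqP #|C| #|Q|) => [le|/ltnW le].
  by rewrite /unpaired_upper (paired_upper_full le) setDv sub0set.
have [c e] := backward_carrier le.
have [c' e'] := backward_carrier (leq_trans le (subset_leq_card sC)).
by rewrite /unpaired_upper e e'; apply: unserved_services sC c c'; apply: ord_pred_connected.
Qed.

Definition transfer A C := (Rmat (A, C)).1.

Lemma in_transfer A C x : (x \in transfer A C) =
  if x \in A then x \in paired_lower A C else x \in unpaired_upper A C.
Proof.
rewrite /transfer RmatE in_setU; case: ifPn => xA.
  by rewrite orbC; case: (boolP (_ \in unpaired_upper _ _)) => // /unpaired_upper_disjoint; rewrite xA.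
by case: (boolP (_ \in paired_lower _ _)) => // /(subsetP (paired_lower_sub _ _)); rewrite (negbTE xA).
Qed.

Lemma transfer_mono A C C' : C \subset C' -> transfer A C \subset transfer A C'.
Proof.
move=> sC; rewrite /transfer !RmatE setUSS //.
  exact: paired_lower_mono.
exact: unpaired_upper_mono.
Qed.

Lemma card_transfer A C : #|transfer A C| = #|C|.
Proof. by have [] := card_Rmat A C. Qed.

Lemma transfer0 A : transfer A set0 = set0.
Proof. by apply: cards0_eq; rewrite card_transfer cards0. Qed.

Lemma transfer_comparable A C : (transfer A C \subset A) || (A \subset transfer A C).
Proof.
case: (leqP #|C| #|A|) => [le|/ltnW le].
  apply/orP; left; apply/subsetP => x; rewrite in_transfer.
  by case: ifP => // _; rewrite /unpaired_upper (paired_upper_full le) setDv inE.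
apply/orP; right; apply/subsetP => x xA.
by rewrite in_transfer xA (paired_lower_full le).
Qed.

Lemma transferK A B : transfer (Rmat (A, B)).1 (Rmat (A, B)).2 = A.
Proof. by rewrite /transfer -surjective_pairing RmatK. Qed.

(** The first component of the Yang-Baxter equation for [(A, B, C)]: the last
    [R_2] on one side does not change it. *)
Lemma transfer_exchange A B C :
  transfer (Rmat (A, B)).1 (transfer (Rmat (A, B)).2 C) = transfer A (transfer B C).
Proof.
have := braidP (A, B, C); rewrite /braid /R12 /R23 /transfer.
case: (Rmat (A, B)) => A1 B1; case: (Rmat (B1, C)) => B2 C2 /=.
case: (Rmat (A1, B2)) => A3 B3; case: (Rmat (B, C)) => B4 C4 /=.
case: (Rmat (A, B4)) => A5 B5 /=.
by case: (Rmat (B5, C4)) => B6 C6 [].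
Qed.

(** * The projection pi as a sum of columns *)

(* Prevents conversion from running the bracket matching. *)
Local Opaque transfer Rmat.

Arguments Rmat_at : simpl never.

Lemma Rmat_at1 A B (b : mlq n) : Rmat_at 1 [:: A, B & b] = [:: (Rmat (A, B)).1, (Rmat (A, B)).2 & b].
Proof. by []. Qed.

Lemma Rmat_atS A (b : mlq n) i : Rmat_at i.+2 (A :: b) = A :: Rmat_at i.+1 b.
Proof. by []. Qed.

(** The sets whose indicators are summed in [pi]: the [i]-th one is row [i] of
    [b] carried down to the bottom. *)
Fixpoint columns (b : mlq n) : mlq n :=
  if b is A :: b' then A :: map (transfer A) (columns b') else [::].

Lemma size_columns (b : mlq n) : size (columns b) = size b.
Proof. by elim: b => //= A b; rewrite size_map => ->. Qed.

Lemma foldr_Rmat_at_cons A (b : mlq n) s : all (leq 1) s ->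
  foldr (@Rmat_at n) (A :: b) (map succn s) = A :: foldr (@Rmat_at n) b s.
Proof. by elim: s => //= -[|i] s IH // /andP[_ /IH ->]. Qed.

Lemma nth_columns (b : mlq n) i : i < size b ->
  nth set0 (columns b) i = mlq_row (Rmat_interval 1 i b) 1.
Proof.
elim: b i => // A b IH [|i] //=; rewrite ltnS => lt.
rewrite (nth_map set0) ?size_columns // IH //.
have -> : Rmat_interval 1 i.+1 (A :: b) = Rmat_at 1 (A :: Rmat_interval 1 i b).
  rewrite /Rmat_interval /index_iota !subn1 /= -foldr_Rmat_at_cons -?[map _ _](iotaDl 1 1 i) //.
  by apply/allP => r; rewrite mem_iota => /andP[].
by [].
Qed.

(** Seen from row [i], the first two columns trade places, because the R matrix is
    an involution, and all others agree by [transfer_exchange]; the rows below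
    [i] then act on each column separately. *)
Lemma columns_Rmat_at (b : mlq n) i : 0 < i < size b ->
  perm_eq (columns (Rmat_at i b)) (columns b).
Proof.
case: i => // i; elim: b i => [|A b IH] i; first by rewrite andbF.
case: i => [|i] lt; last by rewrite Rmat_atS [columns _]/= [columns (A :: b)]/= perm_cons; apply/perm_map/IH.
case: b {IH} lt => [|B b] lt; first by rewrite ltnn in lt.
have swap_head (X Y : {set 'I_n}) s s' : s = s' -> perm_eq [:: X, Y & s] [:: Y, X & s'].
  by move=> ->; apply/permP => P; rewrite /= addnCA.
rewrite Rmat_at1 /= transferK; apply: swap_head.
by rewrite -!map_comp; apply: eq_map => C; apply: transfer_exchange.
Qed.

Definition multiplicity (cs : mlq n) j := \sum_(C <- cs) (j \in C).

Lemma pi_projE (b : mlq n) : pi_proj b = [ffun j => multiplicity (columns b) j].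
Proof.
apply/ffunP => j; rewrite !ffunE /multiplicity (big_nth set0) size_columns.
rewrite big_add1 /= !big_mkord; apply: eq_bigr => i _.
by rewrite ffunE nth_columns.
Qed.

Lemma pi_proj_Rmat_at (b : mlq n) i : 0 < i < size b -> pi_proj (Rmat_at i b) = pi_proj b.
Proof.
move=> hi; rewrite !pi_projE; apply/ffunP => j; rewrite !ffunE.
exact: perm_big (columns_Rmat_at hi).
Qed.

Definition chain (cs : mlq n) := {in cs &, total (fun A B => B \subset A)}.

Lemma columns_chain (b : mlq n) : chain (columns b).
Proof.
elim: b => // A b IH B C /=; rewrite !inE.
case/predU1P => [->|/mapP[B' hB ->]]; case/predU1P => [->|/mapP[C' hC ->]].
- by rewrite subxx.
- exact: transfer_comparable.
- by rewrite orbC transfer_comparable.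
- by case/orP: (IH _ _ hB hC) => /(transfer_mono A) ->; rewrite ?orbT.
Qed.

(** Sorted decreasingly, the [r]-th member of a chain consists of the points that
    lie in at least [r] members. *)
Lemma chain_levels (cs : mlq n) : chain cs ->
  perm_eq cs [seq [set j | r <= multiplicity cs j] | r <- iota 1 (size cs)].
Proof.
move=> ch; set rel := fun A B => B \subset A in ch.
have p : perm_eq cs (sort rel cs) by rewrite perm_sym perm_sort.
have m j : multiplicity cs j = multiplicity (sort rel cs) j by exact: perm_big p.
have srt : sorted rel (sort rel cs) by apply: (sort_sorted_in ch); apply/allP.
have -> : [seq [set j | r <= multiplicity cs j] | r <- iota 1 (size cs)] =
    [seq [set j | r <= multiplicity (sort rel cs) j] | r <- iota 1 (size (sort rel cs))].
  by rewrite size_sort; apply: eq_map => r; apply/setP => j; rewrite !inE m.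
rewrite (perm_trans p) //; move: srt; move: (sort rel cs) => {m p ch}{}cs srt.
suff -> : [seq [set j | r <= multiplicity cs j] | r <- iota 1 (size cs)] = cs by [].
elim: cs srt => //= C cs IH.
rewrite path_sortedE; last by move=> ? ? ? h h'; exact: subset_trans h' h.
case/andP => /allP sC /IH e.
have outside j : j \notin C -> multiplicity cs j = 0.
  move=> jC; rewrite /multiplicity big_seq big1 // => D /sC /subsetP sDC.
  by case: (boolP (j \in D)) => // /sDC; rewrite (negbTE jC).
congr cons.
  apply/setP => j; rewrite inE /multiplicity big_cons.
  by case: (boolP (j \in C)) => // /outside; rewrite /multiplicity => ->.
rewrite -[in RHS]e (iotaDl 1 1) -map_comp; apply/eq_in_map => r; rewrite mem_iota => /andP[r0 _].
apply/setP => j; rewrite !inE /multiplicity big_cons /= -/(multiplicity cs j).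
case: (boolP (j \in C)) => [|/outside ->]; first by rewrite add1n.
by rewrite addn0 !leqn0; case: r r0.
Qed.

(** * The row operator *)

(** Every condition on a level [r] that occurs in the operator [Q^(l)] is of the
    form [r <= r0]. *)
Lemma antitone_cut (p : pred nat) N : (forall r, p r.+1 -> p r) -> ~~ p N.+1 ->
  exists2 r0, r0 <= N & forall r, 0 < r -> p r = (r <= r0).
Proof.
move=> anti; have le r k : p (r + k) -> p r by elim: k => [|k IH]; rewrite ?addn0 // addnS => /anti.
elim: N => [|N IH] pN.
  exists 0 => // r r0; rewrite leqn0 (gtn_eqF r0); apply/negbTE; apply: contra pN.
  by rewrite -(subnKC r0); apply: le.
case: (boolP (p N.+1)) => [p1|/IH[r0 h1 h2]]; last by exists r0; rewrite // leqW.
exists N.+1 => // r r0; case: leqP => h; first by rewrite (le r (N.+1 - r)) // subnKC.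
by apply/negbTE; apply: contra pN; rewrite -(subnKC h); apply: le.
Qed.

Lemma sum_cut l N r0 : r0 <= N -> \sum_(l.+1 <= r < N.+1) (r <= r0) = r0 - l.
Proof.
move=> le; case: (leqP r0 l) => [r0l|lr0].
  by rewrite big_nat big1 => [|r hr]; [lia | apply/eqP; rewrite eqb0; lia].
have -> : \sum_(l.+1 <= r < N.+1) (r <= r0) =
    \sum_(l.+1 <= r < r0.+1) (r <= r0) + \sum_(r0.+1 <= r < N.+1) (r <= r0).
  by rewrite -big_cat_nat //; lia.
have -> : \sum_(l.+1 <= r < r0.+1) (r <= r0) = \sum_(l.+1 <= r < r0.+1) 1.
  by apply: eq_big_nat => r /andP[_]; rewrite ltnS => ->.
rewrite sum_nat_const_nat muln1 big_nat big1 ?addn0 // => r hr.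
by apply/eqP; rewrite eqb0; lia.
Qed.

Lemma last_filter_iota (P : pred nat) (a k : nat) : 0 < k ->
  let s := last a (filter P (iota a k)) in
  [/\ a <= s < a + k, forall r, s < r < a + k -> ~~ P r & P s \/ s = a].
Proof.
case: k => // k _; elim: k => [|k [IH1 IH2 IH3]].
  rewrite /=; case: ifP => h /=; split; rewrite ?leqnn ?addn1 ?ltnS //; try lia; by [right | left].
rewrite -[k.+2]addn1 iotaD filter_cat last_cat.
set s := last a _ in IH1 IH2 IH3 *; rewrite /=.
case: ifP => h; split=> //=.
- by lia.
- by move=> r; lia.
- by left.
- by lia.
- move=> r hr; have [->|ne] := eqVneq r (a + k.+1); first by rewrite h.
  by apply: IH2; lia.
Qed.

(** Between the threshold [s] and the largest entry the level sets are smaller than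
    [Q], so that they are entirely paired; at [s] it is [Q] that is entirely paired, unless [s] has its
    default value. *)
Lemma thresholdP Q u : min_pos_entry u <= max_entry u ->
  let s := threshold Q u in
  [/\ min_pos_entry u <= s <= max_entry u,
      forall r, s < r <= max_entry u -> #|level u r| < #|Q|
    & #|Q| <= #|level u s| \/ s = min_pos_entry u].
Proof.
move=> le; have [|h1 h2 h3] := @last_filter_iota (fun r => #|Q| <= #|level u r|)
  (min_pos_entry u) ((max_entry u).+1 - min_pos_entry u); first by rewrite subn_gt0 ltnS.
rewrite (subnKC (leqW le)) in h1 h2.
split; [exact: h1 | | exact: h3] => r hr.
by rewrite ltnNge; apply: h2.
Qed.

(** Within each phase the sets written are disjoint, so that a site is
    written at most once: [r0] is the only level at which [j] can be written, and a
    value of [r0] outside of [rs] stands for a site that is left alone. *)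
Lemma foldl_overwrite (y : word n) (S : nat -> {set 'I_n}) (v : nat -> nat) (rs : seq nat) j r0 :
  {in rs, forall r, (j \in S r) = (r == r0)} ->
  foldl (fun (z : word n) r => overwrite z (S r) (v r)) y rs j = if r0 \in rs then v r0 else y j.
Proof.
elim: rs y => //= r rs IH y h; rewrite IH; last by move=> k hk; apply: h; rewrite inE hk orbT.
rewrite inE ffunE h ?inE ?eqxx // eq_sym.
by case: eqP => [->|]; case: ifP.
Qed.

Lemma nonzero_entry u : u != zero_word n -> exists x, u x != 0.
Proof.
move=> u0; apply/existsP; apply: contraNT u0; rewrite negb_exists => /forallP h.
by apply/eqP/ffunP => x; rewrite ffunE; apply/eqP/negPn.
Qed.

Lemma max_entry_max u j : u j <= max_entry u.
Proof. exact: leq_bigmax. Qed.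

Lemma min_pos_entry_min u j : u j != 0 -> min_pos_entry u <= u j.
Proof.
rewrite /min_pos_entry; elim: (index_enum _) (mem_index_enum j) => // x s IH.
rewrite inE big_cons => /predU1P[<- -> |/IH h uj]; first exact: geq_minl.
by case: ifP => _; rewrite ?geq_min h ?orbT.
Qed.

Lemma min_pos_entry_ind (P : pred nat) u : P (max_entry u) ->
  (forall j, u j != 0 -> P (u j)) -> P (min_pos_entry u).
Proof.
by move=> h0 h; rewrite /min_pos_entry; elim/big_ind: _ => // x y px py; rewrite /minn; case: ifP.
Qed.

Lemma level_mono u r r' : r <= r' -> level u r' \subset level u r.
Proof. by move=> le; apply/subsetP => j; rewrite !inE; apply: leq_trans. Qed.

Lemma level_min u r : 0 < r <= min_pos_entry u -> level u r = level u (min_pos_entry u).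
Proof.
case/andP=> r0 le; apply/eqP; rewrite eqEsubset (level_mono u le) andbT.
by apply/subsetP => j; rewrite !inE => h; apply: min_pos_entry_min; lia.
Qed.

Lemma level_above u r : max_entry u < r -> level u r = set0.
Proof. by move=> h; apply/setP => j; rewrite !inE leqNgt (leq_ltn_trans (max_entry_max u j)). Qed.

(** The two phases find by search the level [r0] at which site [j] changes its
    status: for [j] in [Q] it is paired at the levels up to [r0], for other [j]
    it is unpaired at the levels up to [r0]. The sum therefore counts [r0 - l]
    levels. The levels from [l + 1] to the smallest entry all coincide, whence
    [r0] is 0 or at least that entry. *)
Lemma row_opE Q l u N j : 0 < l -> u != zero_word n -> l < min_pos_entry u ->
  max_entry u <= N ->
  row_op Q l u j =
    let m := (j \in Q) + \sum_(l.+1 <= r < N.+1) (j \in transfer Q (level u r)) in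
    if m == 0 then 0 else m + l - 1.
Proof.
move=> l0 u0 la KN; set a := min_pos_entry u in la *; set K := max_entry u in KN *.
have aK : a <= K.
  have [x ux] := nonzero_entry u0.
  exact: leq_trans (min_pos_entry_min ux) (max_entry_max u x).
rewrite /row_op (negbTE u0) /collapsing_phase /pairing_phase -/K -/a.
have [/andP[as_ sK] below full] := thresholdP Q aK; set s := threshold Q u in as_ sK below full *.
have small p : (forall r, 0 < r <= a -> p r = p a) -> forall r0,
    (forall r, 0 < r -> p r = (r <= r0)) -> r0 = 0 \/ a <= r0.
  move=> pa r0 cut; case: (leqP a r0) => [|lt]; first by right.
  left; have := pa 1; rewrite !cut; lia.
case: (boolP (j \in Q)) => jQ.
  pose p r := j \in paired_lower Q (level u r).
  have trE r : (j \in transfer Q (level u r)) = p r by rewrite in_transfer jQ.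
  have [||r0 r0K cut] := @antitone_cut p K.
  - by move=> r; apply/subsetP/paired_lower_mono/level_mono.
  - have -> // : p K.+1 = false.
    by rewrite -trE level_above // transfer0 inE.
  have r0s := small p (fun r h => congr1 (fun S => j \in paired_lower Q S) (level_min h)) r0 cut.
  (* At the threshold, [j] is unpaired only if it is unpaired at all levels. *)
  have ps : p s = (0 < r0).
    rewrite cut; last by lia.
    case: r0s => [->|ar0]; first by lia.
    have -> : s <= r0.
      case: full => [le|-> //]; rewrite -cut; last by lia.
      by rewrite /p (paired_lower_full le).
    by lia.
  rewrite (@foldl_overwrite _ _ _ _ _ 0); last first.
    move=> r; rewrite mem_rev mem_index_iota => hr; rewrite in_setD.
    rewrite [X in _ && X](negbTE (contraL (@unpaired_upper_disjoint _ _ _) jQ)) andbF.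
    by apply/esym/negbTE; lia.
  rewrite mem_rev mem_index_iota ifF; last by lia.
  rewrite ffunE in_setD jQ andbT -/(p s) ps.
  rewrite (@foldl_overwrite _ _ _ _ _ r0); last first.
    move=> r; rewrite mem_rev mem_index_iota => hr; rewrite inE -/(p r).
    have r_gt0 : 0 < r by lia.
    apply/andP/eqP => [[pr /allP np]|er].
      rewrite cut // in pr; apply/eqP; rewrite eqn_leq pr /= leqNgt; apply/negP => rr0.
      have : r.+1 \in index_iota r.+1 K.+1 by rewrite mem_index_iota; lia.
      by move/np; rewrite -/(p r.+1) cut // rr0.
    split; first by rewrite cut // er.
    by apply/allP => r'; rewrite mem_index_iota -/(p r') => hr'; rewrite cut; lia.
  rewrite mem_rev mem_index_iota ffunE (eq_bigr (fun r => nat_of_bool (p r)));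
    last by move=> r _; rewrite trE.
  rewrite (eq_big_nat _ _ (F2 := fun r => nat_of_bool (r <= r0)));
    last by move=> r hr; rewrite cut //; lia.
  rewrite sum_cut; last by lia.
  have [e|r0_gt0] := posnP r0; first by rewrite e /= sub0n addn0 /= add1n subn1.
  rewrite /= ifT; last by rewrite r0_gt0 in ps; rewrite -cut ?ps //; lia.
  lia.
pose p r := j \in unpaired_upper Q (level u r).
have trE r : (j \in transfer Q (level u r)) = p r by rewrite in_transfer (negbTE jQ).
have [||r0 r0K cut] := @antitone_cut p K.
- by move=> r; apply/subsetP/unpaired_upper_mono/level_mono.
- have -> // : p K.+1 = false.
  by rewrite -trE level_above // transfer0 inE.
have r0s := small p (fun r h => congr1 (fun S => j \in unpaired_upper Q S) (level_min h)) r0 cut.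
have r0_le_s : r0 <= s.
  rewrite leqNgt; apply/negP => lt.
  have : p r0 by rewrite cut //; lia.
  by rewrite /p /unpaired_upper paired_upper_full ?setDv ?inE // ltnW // below // lt.
rewrite (@foldl_overwrite _ _ _ _ _ r0); last first.
  move=> r; rewrite mem_rev mem_index_iota => hr; rewrite in_setD -/(p r) -/(p r.+1).
  by rewrite !cut //; lia.
rewrite mem_rev mem_index_iota ffunE in_setD (negbTE jQ) andbF.
rewrite (@foldl_overwrite _ _ _ _ _ 0); last first.
  move=> r; rewrite mem_rev mem_index_iota => hr; rewrite !inE (negbTE jQ) /=.
  by apply/esym/negbTE; lia.
rewrite mem_rev mem_index_iota ffunE (eq_bigr (fun r => nat_of_bool (p r)));
    last by move=> r _; rewrite trE.
rewrite (eq_big_nat _ _ (F2 := fun r => nat_of_bool (r <= r0)));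
    last by move=> r hr; rewrite cut //; lia.
rewrite sum_cut; last by lia.
case: r0s => [->|ar0].
  by rewrite sub0n /= !ifF //; lia.
by rewrite /= ifT ?ifF; lia.
Qed.

Lemma row_op_zero Q l : row_op Q l (zero_word n) = [ffun j => l * indicator Q j].
Proof. by rewrite /row_op eqxx. Qed.

Local Opaque row_op.

(** The rows of [b] carry the numbers [l], [l + 1], and so on. *)
Fixpoint stack l (b : mlq n) : word n :=
  if b is Q :: b' then row_op Q l (stack l.+1 b') else zero_word n.

Lemma PhiE (b : mlq n) : Phi b = stack 1 b.
Proof.
rewrite /Phi; have H p c : foldr (fun i w => row_op (mlq_row (p ++ c) i) i w) (zero_word n)
    (iota (size p).+1 (size c)) = stack (size p).+1 c.
  elim: c p => [p|Q c IH p]; first by [].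
  rewrite [iota _ _]/= [LHS]/= [RHS]/=.
  have -> : mlq_row (p ++ Q :: c) (size p).+1 = Q by rewrite /mlq_row nth_cat ltnn subnn.
  by rewrite -cat_rcons -(size_rcons p Q) IH.
exact: (H [::] b).
Qed.

(** By [chain_levels] the superlevel sets of the word of the upper rows are their
    columns, and the offset [l] makes the [r]-th column the level [l + r]. *)
Lemma stackE l (b : mlq n) j : 0 < l ->
  stack l b j = let m := multiplicity (columns b) j in if m == 0 then 0 else m + l - 1.
Proof.
elim: b l j => [|Q b IH] l j l0; first by rewrite /= ffunE /multiplicity big_nil.
set u := stack l.+1 b; set N := l + size b.
have uE x : u x = if multiplicity (columns b) x == 0 then 0 else multiplicity (columns b) x + l.
  by rewrite /u IH //= addnS subn1.
have mE : multiplicity (columns (Q :: b)) j =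
    (j \in Q) + \sum_(l.+1 <= r < N.+1) (j \in transfer Q (level u r)).
  rewrite /multiplicity /= big_cons big_map; congr (_ + _).
  rewrite (perm_big _ (chain_levels (@columns_chain b))) size_columns big_map /=.
  have -> : index_iota l.+1 N.+1 = map (addn l) (iota 1 (size b)).
    by rewrite -iotaDl addn1 /index_iota subSS /N addKn.
  rewrite big_map; apply: eq_big_seq => r; rewrite mem_iota => /andP[r0 _].
  congr (nat_of_bool (j \in transfer Q _)); apply/setP => x; rewrite !inE uE.
  by case: eqP => [->|_]; [lia | rewrite addnC leq_add2r].
rewrite mE -[stack l _]/(row_op Q l u).
have [u0|u0] := eqVneq u (zero_word n).
  rewrite u0 row_op_zero ffunE ffunE big_nat big1 => [|r /andP[lr _]].
    by case: (j \in Q); rewrite /= ?muln0 // muln1 addn0 add1n subn1.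
  rewrite (_ : level _ _ = set0) ?transfer0 ?inE //.
  by apply/setP => x; rewrite !inE ffunE; lia.
have big x : u x != 0 -> l < u x by rewrite uE; case: ifP => // /negbT; lia.
have lmin : l < min_pos_entry u.
  apply: (min_pos_entry_ind (P := fun a : nat => l < a) _ big).
  have [x ux] := nonzero_entry u0.
  exact: leq_trans (big x ux) (max_entry_max u x).
have maxN : max_entry u <= N.
  apply/bigmax_leqP => x _; rewrite uE; case: ifP => // _.
  rewrite addnC leq_add2l /multiplicity -(size_columns b) -sum1_size.
  by apply: leq_sum => C _; case: (x \in C).
exact: row_opE l0 u0 lmin maxN.
Qed.

End Circle.

Theorem theorem4p4 (n : nat) (hn : 1 <= n) (alpha : seq nat) (b : mlq n)
    (hb : is_mlq alpha b) (i : nat) (hi : 1 <= i < size alpha) :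
  pi_proj (Rmat_at i b) = pi_proj b /\ Phi (sigma i b) = Phi b.
Proof.
have hi' : 0 < i < size b by rewrite -hb size_map in hi.
have Phi_pi c : Phi c = pi_proj c.
  rewrite PhiE pi_projE; apply/ffunP => j; rewrite ffunE stackE //=.
  by case: eqP => [->|_] //; rewrite addn1 subn1.
split; first exact: pi_proj_Rmat_at.
by rewrite !Phi_pi -(pi_proj_Rmat_at hi').
Qed.
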